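(* Let $\mathsf{H}^{(r)}_m$ denote the $r$-th derivative of the shifted Horadam polynomial $\mathsf{H}_m$. For all integers $r\ge 1$ and $m\ge r$, $$\mathsf{H}^{(r)}_{m}(0)=-\frac{\Gamma\left(-r-\frac12\right)(m+r+1)!}{2\sqrt{\pi}\,(m-r)!}.$$ In particular, $$\mathsf{H}'_{m}(0)=-\frac{2(m+2)(m+1)m}{3}\quad(m\ge1),$$ $$\mathsf{H}''_{m}(0)=\frac{4(m-1)m(m+1)(m+2)(m+3)}{15}\quad(m\ge2),$$ $$\mathsf{H}'''_{m}(0)=-\frac{8(m-2)(m-1)m(m+1)(m+2)(m+3)(m+4)}{105}\quad(m\ge3),$$ $$\mathsf{H}^{(4)}_{m}(0)=\frac{16(m-3)(m-2)(m-1)m(m+1)(m+2)(m+3)(m+4)(m+5)}{945}\quad(m\ge4).$$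
   Context: The shifted Horadam polynomials $\mathsf{H}_m(x)$, $m=0,1,2,\dots$, are defined by $\mathsf{H}_0(x)=1$, $\mathsf{H}_1(x)=-2(2x-1)$, and $\mathsf{H}_m(x)=-2(2x-1)\mathsf{H}_{m-1}(x)-\mathsf{H}_{m-2}(x)$ for $m\ge 2$. $\Gamma$ is the Gamma function. *)

(* Defs.v *)
From HB Require Import structures.
From mathcomp Require Import all_boot all_order all_algebra.
From mathcomp Require Import all_classical all_reals all_analysis.

Set Implicit Arguments.
Unset Strict Implicit.
Unset Printing Implicit Defensive.

Import Order.TTheory GRing.Theory Num.Theory.

Local Open Scope classical_set_scope.
Local Open Scope ring_scope.

Fixpoint horadam (R : nzRingType) (m : nat) {struct m} : {poly R} :=
  match m with
  | 0 => 1
  | m'.+1 =>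
    match m' with
    | 0 => - 2 * (2 * 'X - 1)
    | m''.+1 => - 2 * (2 * 'X - 1) * horadam R m' - horadam R m''
    end
  end.

Definition gamma_integral (R : realType) (x : R) : R :=
  \int[lebesgue_measure]_(t in `]0, +oo[) (t `^ (x - 1) * expR (- t)).

(* The Gamma function on the real line: Euler's integral for 0 < x, where
   Num.truncn (1 - x) = 0, extended to x < 0 by the functional equation
   Gamma (x + 1) = x * Gamma x, iterated the least number n of times that
   makes x + n positive. At the poles 0, -1, -2, ... the product vanishes
   and Gamma takes the meaningless value 0. *)
Definition Gamma (R : realType) (x : R) : R :=
  let n := Num.truncn (1 - x) in
  gamma_integral (x + n%:R) / \prod_(i < n) (x + i%:R).

(* Main.v *)
(** The polynomial H_m satisfies H_m(x) = U_m(1 - 2x), with U_m the Chebyshev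
    polynomial of the second kind, and Pascal's rule turns the recurrence into
    the closed form (-4)^r C(m + r + 1, 2r + 1) for the coefficient of x^r.
    On the other side, the functional equation gives
    Gamma(-r - 1/2) = (-2)^(r+1) Gamma(1/2) / (2r + 1)!!, and the substitution
    x = sqrt t in the Gaussian integral yields Gamma(1/2) = sqrt pi. *)

Require Import Defs.
From HB Require Import structures.
From mathcomp Require Import all_boot all_order all_algebra.
From mathcomp Require Import all_classical all_reals all_analysis.
From mathcomp Require Import measurable_realfun ring lra zify.

Import Order.TTheory GRing.Theory Num.Theory.
Import numFieldNormedType.Exports.

Local Open Scope ring_scope.
Local Open Scope classical_set_scope.

(** * The value of Gamma at 1/2 *)

Lemma cvgy_sqrt (R : realType) : @Num.sqrt R x @[x --> +oo] --> +oo.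
Proof.
apply/cvgryPge => A; near=> x.
have Ax : A ^+ 2 <= x by near: x; apply: nbhs_pinfty_ge; exact: num_real.
by rewrite (le_trans (ler_norm A))// -sqrtr_sqr ler_wsqrtr.
Unshelve. all: by end_near. Qed.

Lemma derive1_sqrt (R : realType) (x : R) :
  0 < x -> Num.sqrt^`() x = (2 * Num.sqrt x)^-1.
Proof. by move=> x0; rewrite derive1E derive_sqrt. Qed.

(** The closed form of the derivative is available only at positive points, so limits are
    transferred along any filter that eventually stays there; this serves both at finite points and
    at [+oo]. *)
Lemma cvg_derive1_sqrt (R : realType) (F : set_system R) {FF : Filter F}
    (l : R) :
  (\forall x \near F, 0 < x) ->
  (2 * Num.sqrt x)^-1 @[x --> F] --> l -> Num.sqrt^`() x @[x --> F] --> l.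
Proof.
move=> F0; apply: cvg_trans; apply: near_eq_cvg; near=> x.
by rewrite derive1_sqrt//; near: x.
Unshelve. all: by end_near. Qed.

Lemma continuous_derive1_sqrt (R : realType) (x : R) :
  0 < x -> {for x, continuous (Num.sqrt^`() : R -> R)}.
Proof.
move=> x0; rewrite /prop_for /continuous_at derive1_sqrt//.
apply: cvg_derive1_sqrt; first exact: lt_nbhsr.
apply: (@cvgV _ _ _ _ (fun y : R => 2 * Num.sqrt y)).
  by rewrite mulf_neq0// gt_eqF// sqrtr_gt0.
by apply: cvgM; [exact: cvg_cst|exact: sqrt_continuous].
Qed.

(* The library's substitution rule needs a derivative with finite limits at both
   ends, which excludes t = x ^+ 2 at +oo and x = sqrt t at 0: hence sqrt, on a
   half-line bounded away from 0. *)
Lemma integral_gauss_tail (R : realType) (a : R) : 0 < a ->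
  (\int[lebesgue_measure]_(x in `[Num.sqrt a, +oo[) (gauss_fun x)%:E =
   \int[lebesgue_measure]_(t in `[a, +oo[)
     (2^-1 * (t `^ (2^-1 - 1) * expR (- t)))%:E)%E.
Proof.
move=> a0.
rewrite (increasing_ge0_integration_by_substitutiony (F := @Num.sqrt R)).
- apply: eq_integral => t; rewrite inE/= in_itv/= andbT => at_.
  have t0 : 0 < t by exact: lt_le_trans at_.
  rewrite /= !fctE /= derive1_sqrt// /gauss_fun sqr_sqrtr ?ltW//.
  have -> : 2^-1 - 1 = - 2^-1 :> R by lra.
  rewrite powRN powR12_sqrt ?ltW// invfM; congr EFin; ring.
- move=> x y; rewrite !in_itv/= !andbT => ax ay xy.
  by rewrite ltr_sqrt// (lt_le_trans a0)// (le_trans ax)// ltW.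
- move=> x; rewrite in_itv/= andbT => ax.
  exact/continuous_derive1_sqrt/(lt_trans a0).
- apply/cvg_ex; eexists; apply: cvg_at_right_filter.
  exact: continuous_derive1_sqrt.
- apply/cvg_ex; exists 0; apply: cvg_derive1_sqrt.
    by apply: nbhs_pinfty_gt; exact: num_real.
  apply/gtr0_cvgV0; last by apply: gt0_cvgMry => //; exact: cvgy_sqrt.
  near=> x; rewrite mulr_gt0// sqrtr_gt0.
  by near: x; apply: nbhs_pinfty_gt; exact: num_real.
- split.
    move=> x; rewrite in_itv/= andbT => ax.
    by have [] := is_derive1_sqrt (lt_trans a0 ax).
  exact/cvg_at_right_filter/sqrt_continuous.
- exact: cvgy_sqrt.
- exact/continuous_subspaceT/continuous_gauss_fun.
- by move=> x _; exact: gauss_fun_ge0.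
Unshelve. all: by end_near. Qed.

(** The half-lines from [1/(k+1)] exhaust []0, +oo[], and so do their images under the square root.
    Substitution identifies the two integrals for each [k], and monotone convergence passes to the
    limit on both sides. *)
Lemma gamma_integral_half (R : realType) :
  gamma_integral (2^-1 : R) = Num.sqrt pi.
Proof.
set f := fun t : R => t `^ (2^-1 - 1) * expR (- t).
have f0 t : 0 <= f t by rewrite mulr_ge0 ?powR_ge0 ?expR_ge0.
have mf : measurable_fun setT f.
  apply: measurable_funM; first exact: measurable_powR.
  by apply: measurableT_comp => //; exact: oppr_measurable.
set F := fun k : nat => `[k.+1%:R^-1 : R, +oo[%classic.
set G := fun k : nat => `[Num.sqrt (k.+1%:R^-1 : R), +oo[%classic.
have invS i j : (i <= j)%N -> j.+1%:R^-1 <= i.+1%:R^-1 :> R.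
  by move=> ij; rewrite lef_pV2 ?posrE// ler_nat.
have UF : \bigcup_k F k = `]0, +oo[.
  by rewrite itvoyEbigcup; apply: eq_bigcupr => k _; rewrite add0r.
have UG : \bigcup_k G k = `]0, +oo[.
  apply/seteqP; split => x /=.
    move=> [k _]; rewrite /G/= !in_itv/= !andbT; apply: lt_le_trans.
    by rewrite sqrtr_gt0 invr_gt0.
  rewrite in_itv/= andbT => x0.
  (* The index comes from the first union: [x] lies in [G k] as soon as [x ^+ 2] lies in [F k]. *)
  have : `]0, +oo[ (x ^+ 2) by rewrite /= in_itv/= andbT exprn_gt0.
  rewrite -UF => -[k _]; rewrite /F/= in_itv/= andbT => kx.
  exists k => //; rewrite /G/= in_itv/= andbT.
  by rewrite -(ger0_norm (ltW x0)) -sqrtr_sqr ler_wsqrtr.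
have cvgF : (\int[lebesgue_measure]_(t in F k) (2^-1 * f t)%:E)%E @[k --> \oo]
    --> (\int[lebesgue_measure]_(t in `]0%R, +oo[) (2^-1 * f t)%:E)%E.
  rewrite -UF; apply: ge0_nondecreasing_set_cvg_integral.
  - by move=> i j ij; apply/subsetPset/subset_itvr; rewrite bnd_simp invS.
  - by move=> i; exact: measurable_itv.
  - move=> i; apply/measurable_EFinP/measurable_funTS.
    by apply: measurable_funM => //; exact: measurable_cst.
  - by move=> i x _; rewrite lee_fin mulr_ge0.
have cvgG : (\int[lebesgue_measure]_(t in G k) (gauss_fun t)%:E)%E @[k --> \oo]
    --> (\int[lebesgue_measure]_(t in `]0%R, +oo[) (gauss_fun t)%:E)%E.
  rewrite -UG; apply: ge0_nondecreasing_set_cvg_integral.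
  - move=> i j ij; apply/subsetPset/subset_itvr.
    by rewrite bnd_simp ler_wsqrtr// invS.
  - by move=> i; exact: measurable_itv.
  - move=> i; apply/measurable_EFinP/measurable_funTS.
    exact: measurable_gauss_fun.
  - by move=> i x _; rewrite lee_fin gauss_fun_ge0.
have half : (\int[lebesgue_measure]_(t in `]0%R, +oo[) (2^-1 * f t)%:E =
    (Num.sqrt pi / 2)%:E)%E.
  (* The Gaussian integral is over the closed half-line; dropping the null set {0} gives the limit
     in [cvgG]. *)
  rewrite -integral0y_gauss -integral_itv_obnd_cbnd; last first.
    apply/measurable_EFinP/measurable_funTS; exact: measurable_gauss_fun.
  apply: (cvg_unique _ cvgF) => //; move: cvgG; apply: cvg_trans.
  apply: near_eq_cvg; apply: nearW => k.
  by rewrite integral_gauss_tail// invr_gt0.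
rewrite /gamma_integral /Rintegral.
suff -> : (\int[lebesgue_measure]_(t in `]0%R, +oo[) (f t)%:E =
    (Num.sqrt pi)%:E)%E by [].
transitivity (\int[lebesgue_measure]_(t in `]0%R, +oo[)
    (2%:E * (2^-1 * f t)%:E))%E.
  by apply: eq_integral => t _; rewrite -EFinM mulrA divff// mul1r.
rewrite ge0_integralZl_EFin//.
- by rewrite half -EFinM mulrC divfK.
- by move=> t _; rewrite lee_fin mulr_ge0.
- apply/measurable_EFinP/measurable_funTS.
  by apply: measurable_funM => //; exact: measurable_cst.
Qed.

(** * Taylor coefficients at 0 *)

(** No bound on [r] is required: beyond the degree [m] the binomial coefficient vanishes. Strong
    induction matches the two-step recurrence. *)
Lemma coef_horadam (R : comNzRingType) (m r : nat) :
  (horadam R m)`_r = (-4) ^+ r * ('C(m + r + 1, 2 * r + 1))%:R.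
Proof.
elim/ltn_ind: m r => -[|[|m]] IH r.
- rewrite [horadam _ _]/= coef1; case: r => [|r]; first by rewrite mul1r.
  by rewrite bin_small ?mulr0//; lia.
- have -> : horadam R 1 = 2%:R%:P + (-4)%:P * 'X.
    by rewrite /= !(rmorphN, rmorph_nat); ring.
  rewrite coefD coefC coefMX coefC.
  case: r => [|[|r]]; rewrite ?addr0 ?add0r ?eqxx/=.
  + by rewrite mul1r.
  + by rewrite expr1 mulr1.
  + by rewrite bin_small ?mulr0//; lia.
have -> : horadam R m.+2 = 2%:R%:P * horadam R m.+1 +
    (-4)%:P * (horadam R m.+1 * 'X) - horadam R m.
  by rewrite [LHS]/= -/(horadam R m.+1) !(rmorphN, rmorph_nat); ring.
rewrite coefB coefD !coefCM coefMX !IH//.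
(* Multiplication by ['X] shifts indices, so the constant coefficient gets no contribution from that
   term. *)
case: r => [|r] /=; first by rewrite !bin1 !addn0 !addn1 -!natr1; ring.
rewrite exprS.
have -> : (m.+2 + r.+1 + 1 = (m + r + 2).+2)%N by lia.
have -> : (m.+1 + r.+1 + 1 = (m + r + 2).+1)%N by lia.
have -> : (m.+1 + r + 1 = m + r + 2)%N by lia.
have -> : (m + r.+1 + 1 = m + r + 2)%N by lia.
have -> : (2 * r.+1 + 1 = (2 * r + 1).+2)%N by lia.
(* With n = m + r + 2 and k = 2r + 1, this is C(n+2, k+2) = 2 C(n+1, k+2) + C(n, k) - C(n, k+2). *)
by rewrite !binS !natrD; ring.
Qed.

Lemma derivn_horadam0 (R : comNzRingType) (m r : nat) :
  (horadam R m)^`(r).[0] =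
    (-4) ^+ r * (r`! * 'C(m + r + 1, 2 * r + 1))%:R.
Proof.
by rewrite horner_coef0 coef_derivn addn0 ffactnn coef_horadam -mulr_natr
  natrM; ring.
Qed.

Lemma prod_odd_neq0 (R : numDomainType) (n : nat) :
  (\prod_(i < n) (2 * i + 1))%:R != 0 :> R.
Proof.
by rewrite pnatr_eq0 -lt0n; apply: prodn_gt0 => i; rewrite addn1.
Qed.

(** The denominator is the double factorial (2r+1)!!. Since (2r+1)! = 2^r r! (2r+1)!!, the factor r!
    cancels and (-4)^r becomes (-2)^r. *)
Lemma derivn_horadam0_ffact (R : numFieldType) (m r : nat) :
  (horadam R m)^`(r).[0] =
    (-2) ^+ r * ((m + r + 1) ^_ (2 * r + 1))%:R
    / (\prod_(i < r.+1) (2 * i + 1))%:R.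
Proof.
rewrite derivn_horadam0 -bin_ffact; apply: (mulIf (prod_odd_neq0 R r.+1)).
rewrite divfK ?prod_odd_neq0//.
have -> : ((2 * r + 1)`! = 2 ^ r * r`! * \prod_(i < r.+1) (2 * i + 1))%N.
  elim: r => [|r IH]; first by rewrite big_ord_recl big_ord0.
  rewrite big_ord_recr/= expnS factS.
  have -> : (2 * r.+1 + 1 = (2 * r + 1).+2)%N by lia.
  by rewrite !factS IH; ring.
rewrite (_ : -4 = -2 * 2 :> R); last by ring.
by rewrite exprMn !natrM natrX; ring.
Qed.

(** * Gamma at negative half-integers, and the conclusion *)

Lemma Gamma_half_sub (R : realType) (r : nat) :
  Gamma (- r%:R - 2^-1 : R) =
    (-2) ^+ r.+1 * Num.sqrt pi / (\prod_(i < r.+1) (2 * i + 1))%:R.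
Proof.
(* Here 1 - x = r + 3/2 has integer part r + 1, the number of unit shifts that bring x to 1/2. *)
rewrite /Gamma (@truncn_def _ _ r.+1); last first.
  by rewrite -[r.+2%:R]natr1 -[r.+1%:R]natr1; apply/andP; split; lra.
have -> : - r%:R - 2^-1 + r.+1%:R = 2^-1 :> R by rewrite -[r.+1%:R]natr1; lra.
rewrite gamma_integral_half.
suff -> : \prod_(i < r.+1) (- r%:R - 2^-1 + i%:R : R) =
   (\prod_(i < r.+1) (2 * i + 1))%:R / (-2) ^+ r.+1.
  by rewrite invf_div mulrCA mulrA.
(* Read backwards, the i-th factor is -i - 1/2 = (2i + 1) / (-2). *)
rewrite (reindex_inj rev_ord_inj)/=.
rewrite natr_prod -exprVn -[X in _ * _ ^+ X]card_ord -prodr_const -big_split/=.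
apply: eq_bigr => i _.
by rewrite subSS natrB -1?ltnS// natrD natrM; field.
Qed.

Theorem corollary2p1 (R : realType) :
  (forall r m : nat, (1 <= r)%N -> (r <= m)%N ->
     (horadam R m)^`(r).[0] =
       - (Gamma (- r%:R - 2^-1 : R) * ((m + r + 1)`!)%:R
          / (2 * Num.sqrt pi * ((m - r)`!)%:R)))
  /\ (forall m : nat, (1 <= m)%N ->
     (horadam R m)^`().[0] =
       - (2 * (m%:R + 2) * (m%:R + 1) * m%:R / 3))
  /\ (forall m : nat, (2 <= m)%N ->
     (horadam R m)^`(2).[0] =
       4 * (m%:R - 1) * m%:R * (m%:R + 1) * (m%:R + 2) * (m%:R + 3) / 15)
  /\ (forall m : nat, (3 <= m)%N ->
     (horadam R m)^`(3).[0] =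
       - (8 * (m%:R - 2) * (m%:R - 1) * m%:R * (m%:R + 1) * (m%:R + 2)
          * (m%:R + 3) * (m%:R + 4) / 105))
  /\ (forall m : nat, (4 <= m)%N ->
     (horadam R m)^`(4).[0] =
       16 * (m%:R - 3) * (m%:R - 2) * (m%:R - 1) * m%:R * (m%:R + 1)
          * (m%:R + 2) * (m%:R + 3) * (m%:R + 4) * (m%:R + 5) / 945).
Proof.
split; last split; last split; last split.
- move=> r m r1 rm; rewrite derivn_horadam0_ffact Gamma_half_sub exprS.
  (* As r <= m, the falling factorial is the quotient of factorials in the claim. *)
  have -> : ((m + r + 1)`! = (m + r + 1) ^_ (2 * r + 1) * (m - r)`!)%N.
    rewrite -(@ffact_fact (m + r + 1) (2 * r + 1)); last by lia.
    by congr (_ * _`!)%N; lia.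
  have sp : Num.sqrt pi != 0 :> R by rewrite gt_eqF// sqrtr_gt0 pi_gt0.
  have fmr : (m - r)`!%:R != 0 :> R by rewrite pnatr_eq0 -lt0n fact_gt0.
  rewrite natrM; field.
  by rewrite sp fmr prod_odd_neq0.
(* In each special case, writing [m] as an r-fold successor makes the truncated subtractions in the
   falling factorial reduce, leaving a field identity. *)
- case=> // m _; rewrite -derivn1 derivn_horadam0_ffact.
  rewrite !big_ord_recr big_ord0/=.
  rewrite !ffactnSr ffactn0 !addnS !addn0 !subSS !subn0 !natrM -!natr1.
  by field.
- case=> [|[|m]]// _; rewrite derivn_horadam0_ffact !big_ord_recr big_ord0/=.
  rewrite !ffactnSr ffactn0 !addnS !addn0 !subSS !subn0 !natrM -!natr1.
  by field.
- case=> [|[|[|m]]]// _; rewrite derivn_horadam0_ffact !big_ord_recr big_ord0/=.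
  rewrite !ffactnSr ffactn0 !addnS !addn0 !subSS !subn0 !natrM -!natr1.
  by field.
- case=> [|[|[|[|m]]]]// _; rewrite derivn_horadam0_ffact.
  rewrite !big_ord_recr big_ord0/=.
  rewrite !ffactnSr ffactn0 !addnS !addn0 !subSS !subn0 !natrM -!natr1.
  by field.
Qed.
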